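(* Let $(T,F,\omega)$ be a polarized Deligne module over $\mathbb F_q$, and let $V:T\to T$ be the endomorphism with $FV=VF=q$. Then $(T,V,-\omega)$ is also a polarized Deligne module. Suppose moreover that $T\otimes\mathbb Q$ is a simple $\mathbb Q[F]$-module. Then $(T,F,\omega)$ and $(T,V,-\omega)$ are isomorphic (as polarized Deligne modules) if and only if $(T,F,\omega)$ admits a real structure, that is, a group isomorphism $\tau:T\to T$ such that (1) $\tau^2=I$, (2) $\tau F\tau^{-1}=V$, (3) $\omega(\tau x,\tau y)=-\omega(x,y)$ for all $x,y\in T$.
   Context: Let $p$ be a prime, $q=p^a$, $k=\mathbb F_q$, and fix an embedding $\varepsilon:W(\bar k)\to\mathbb C$ of the ring of Witt vectors of $\bar k$. A Deligne module of rank $2n$ over $\mathbb F_q$ is a pair $(T,F)$ with $T$ a free $\mathbb Z$-module of rank $2n$ and $F:T\to T$ an endomorphism such that: $F$ is semisimple and all its eigenvalues in $\mathbb C$ have absolute value $\sqrt q$; exactly half of the eigenvalues of $F$ in $\overline{\mathbb Q}_p$ are $p$-adic units and half are divisible by $q$; the middle coefficient of the characteristic polynomial of $F$ is coprime to $p$; there is an endomorphism $V:T\to T$ with $FV=VF=q$. The algebra $\mathbb Q[F]$ is a product of CM fields, with complex conjugation (denoted by a bar) exchanging $F$ and $V$. The embedding $\varepsilon$ determines a $p$-adic valuation $\mathrm{val}_p$ on the algebraic closure of $\mathbb Q$ in $\mathbb C$; let $\Phi_\varepsilon$ be the CM type on $\mathbb Q[F]$ consisting of all homomorphisms $\phi:\mathbb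 Q[F]\to\mathbb C$ with $\mathrm{val}_p(\phi(F))>0$. An element $\iota\in\mathbb Q[F]$ with $\bar\iota=-\iota$ is totally $\Phi_\varepsilon$-positive imaginary if $\phi(\iota)$ is positive imaginary for all $\phi\in\Phi_\varepsilon$. A ($\Phi_\varepsilon$-positive) polarization of $(T,F)$ is an alternating form $\omega:T\times T\to\mathbb Z$, nondegenerate over $\mathbb Q$, with $\omega(Fx,y)=\omega(x,Vy)$, such that $R(x,y)=\omega(x,\iota y)$ is symmetric and positive definite for some (hence any) totally $\Phi_\varepsilon$-positive imaginary $\iota$. For $(T,V,-\omega)$ the roles of $F$ and $V$ are exchanged, so the CM type is the set of $\phi:\mathbb Q[V]\to\mathbb C$ with $\mathrm{val}_p(\phi(V))>0$. An isomorphism $(T_1,F_1,\omega_1)\to(T_2,F_2,\omega_2)$ is a group isomorphism $\psi:T_1\to T_2$ with $\psi F_1=F_2\psi$ and $\psi^*\omega_2=\omega_1$. *)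

(* Defs.v *)
From HB Require Import structures.
From mathcomp Require Import all_boot all_order all_algebra all_field.
From mathcomp Require Import reals complex.
From mathcomp Require Import mpoly.

Set Implicit Arguments.
Unset Strict Implicit.
Unset Printing Implicit Defensive.

Import Order.TTheory GRing.Theory Num.Theory.
Local Open Scope ring_scope.

(** * Witt vectors *)

Definition ghost (A : comNzRingType) (p m : nat) (u : nat -> A) : A :=
  \sum_(i < m.+1) (p ^ i)%:R * u i ^+ (p ^ (m - i)).

(* Over a Q-algebra the ghost map is invertible: [unghost p g m] lists the
   first [m] terms of the sequence [u] such that [ghost p i u = g i]. *)
Fixpoint unghost (A : comAlgType rat) (p : nat) (g : nat -> A) (m : nat) :
    seq A :=
  if m is m'.+1 then
    let s := unghost p g m' in
    rcons s ((p ^ m')%:R^-1 *: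
      (g m' - \sum_(i < m') (p ^ i)%:R * s`_i ^+ (p ^ (m' - i))))
  else [::].

Definition witt_X (n i : nat) : {mpoly rat[n.+1 + n.+1]} :=
  'X_(lshift n.+1 (inord i)).
Definition witt_Y (n i : nat) : {mpoly rat[n.+1 + n.+1]} :=
  'X_(rshift n.+1 (inord i)).

Definition witt_add_poly (p n : nat) : {mpoly rat[n.+1 + n.+1]} :=
  (unghost p (fun m => ghost p m (witt_X n) + ghost p m (witt_Y n)) n.+1)`_n.
Definition witt_mul_poly (p n : nat) : {mpoly rat[n.+1 + n.+1]} :=
  (unghost p (fun m => ghost p m (witt_X n) * ghost p m (witt_Y n)) n.+1)`_n.

(* By Witt's theorem the polynomials above have integer coefficients, so
   [numq] merely reads these off before they are sent to [K]. *)
Definition witt_eval (K : comNzRingType) (n : nat)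
    (S : {mpoly rat[n.+1 + n.+1]}) (x y : nat -> K) : K :=
  mmap (fun c : rat => (numq c)%:~R)
       (fun j => match split j with inl i => x i | inr i => y i end) S.

Definition witt (K : Type) : Type := nat -> K.

Definition witt_one (K : comNzRingType) : witt K := fun n => (n == 0%N)%:R.
Definition witt_add (K : comNzRingType) (p : nat) (x y : witt K) : witt K :=
  fun n => witt_eval (witt_add_poly p n) x y.
Definition witt_mul (K : comNzRingType) (p : nat) (x y : witt K) : witt K :=
  fun n => witt_eval (witt_mul_poly p n) x y.

Definition witt_embedding (K C : comNzRingType) (p : nat)
    (eps : witt K -> C) : Prop :=
  [/\ injective eps,
      eps (witt_one K) = 1,
      forall x y, eps (witt_add p x y) = eps x + eps y
    & forall x y, eps (witt_mul p x y) = eps x * eps y].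

(** * p-adic valuations *)

(* A valuation is a function to [rat] whose value at 0 (which should be
   infinite) is left unspecified. *)
Definition padic_valuation_on (K : fieldType) (p : nat) (S : K -> Prop)
    (v : K -> rat) : Prop :=
  [/\ (p%:R : K) != 0,
      v p%:R = 1,
      forall x y, S x -> S y -> x != 0 -> y != 0 -> v (x * y) = v x + v y
    & forall x y, S x -> S y -> x != 0 -> y != 0 -> x + y != 0 ->
        Num.min (v x) (v y) <= v (x + y)].

(* The elements of the field of fractions of W(K) that eps sends to algebraic
   numbers form a henselian field, over which all algebraic numbers are
   algebraic; hence [v] is determined by [eps] on nonzero algebraic numbers.
   For K perfect of characteristic p, the valuation of a Witt vector is the
   index of its first nonzero component. *)
Definition induced_valuation (K : fieldType) (C : numClosedFieldType) (p : nat)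
    (eps : witt K -> C) (v : C -> rat) : Prop :=
  padic_valuation_on p (algebraicOver (@ratr C)) v /\
  (forall (x : witt K) (m : nat),
     (forall i, (i < m)%N -> x i = 0) -> x m != 0 ->
     algebraicOver (@ratr C) (eps x) -> v (eps x) = m%:R).

Definition padic_close (K : fieldType) (v : K -> rat) (N : nat) (x y : K) :
    Prop :=
  x = y \/ N%:R <= v (x - y).

(* Qp is the completion of Q at p, and Qpbar an algebraic closure of Qp. *)
Record padic_closure (p : nat) := PadicClosure {
  Qp : fieldType;
  Qp_val : Qp -> rat;
  Qp_valP : padic_valuation_on p (fun _ => True) Qp_val;
  Qp_dense : forall (x : Qp) (N : nat),
    exists r : rat, padic_close Qp_val N x (ratr r);
  Qp_complete : forall u : nat -> Qp,
    (forall N, exists m, forall i j, (m <= i)%N -> (m <= j)%N ->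
       padic_close Qp_val N (u i) (u j)) ->
    exists x, forall N, exists m, forall i, (m <= i)%N ->
      padic_close Qp_val N (u i) x;
  Qpbar : closedFieldType;
  Qp_emb : {rmorphism Qp -> Qpbar};
  Qpbar_algebraic : forall x : Qpbar, algebraicOver Qp_emb x;
  Qpbar_val : Qpbar -> rat;
  Qpbar_valP : padic_valuation_on p (fun _ => True) Qpbar_val;
  Qpbar_val_emb : forall x : Qp, x != 0 -> Qpbar_val (Qp_emb x) = Qp_val x
}.

Definition padic_unit (p : nat) (Qb : padic_closure p) (x : Qpbar Qb) : bool :=
  (x != 0) && (Qpbar_val x == 0).

Definition padic_dvd (p : nat) (Qb : padic_closure p) (d x : Qpbar Qb) : bool :=
  (x == 0) || ((d != 0) && (Qpbar_val d <= Qpbar_val x)).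

(** * Free Z-modules, matrices of endomorphisms and forms *)

Record zbasis (T : zmodType) (r : nat) := ZBasis {
  zcoord : {additive T -> 'rV[int]_r};
  zvec : 'rV[int]_r -> T;
  zcoordK : cancel zcoord zvec;
  zvecK : cancel zvec zcoord
}.

(* Row convention: [zcoord b (F x) = zcoord b x *m end_mx b F].  Accordingly
   'rV[K]_r stands for the scalar extension of T to K, with endomorphisms
   acting by multiplication on the right. *)
Definition end_mx (T : zmodType) (r : nat) (b : zbasis T r) (F : T -> T) :
    'M[int]_r :=
  \matrix_(i, j) zcoord b (F (zvec b (delta_mx 0 i))) 0 j.

Definition form_mx (T : zmodType) (r : nat) (b : zbasis T r)
    (w : T -> T -> int) : 'M[int]_r :=
  \matrix_(i, j) w (zvec b (delta_mx 0 i)) (zvec b (delta_mx 0 j)).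

Definition base_change (K : nzRingType) (r : nat) (M : 'M[int]_r) : 'M[K]_r :=
  map_mx intr M.

Definition formQ (T : zmodType) (r : nat) (b : zbasis T r) (w : T -> T -> int)
    (x y : 'rV[rat]_r) : rat :=
  (x *m base_change rat (form_mx b w) *m y^T) 0 0.

Definition semisimple_mx (r : nat) (M : 'M[rat]_r) : Prop :=
  forall U : 'M[rat]_r, stablemx U M ->
    exists U' : 'M[rat]_r,
      [/\ stablemx U' M, (U :&: U' :=: (0 : 'M[rat]_r))%MS & row_full (U + U')%MS].

(* T (x) Q is simple as a Q[F]-module. *)
Definition simple_QF_module (T : zmodType) (r : nat) (b : zbasis T r)
    (F : T -> T) : Prop :=
  (0 < r)%N /\
  (forall U : 'M[rat]_r, stablemx U (base_change rat (end_mx b F)) ->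
     U = 0 \/ row_full U).

(** * Deligne modules *)

Definition is_verschiebung (T : zmodType) (q : nat) (F V : T -> T) : Prop :=
  (forall x, F (V x) = x *+ q) /\ (forall x, V (F x) = x *+ q).

Record is_deligne_module (R : realType) (p a n : nat) (Qb : padic_closure p)
    (T : zmodType) (b : zbasis T (2 * n)) (F : {additive T -> T}) : Prop :=
  IsDeligneModule {
  deligne_semisimple : semisimple_mx (base_change rat (end_mx b F));
  deligne_weil : forall z : R[i],
    eigenvalue (base_change R[i] (end_mx b F)) z ->
    `|z| = sqrtC (p ^ a)%:R;
  deligne_ordinary : exists s : seq (Qpbar Qb),
    [/\ char_poly (base_change (Qpbar Qb) (end_mx b F)) =
          \prod_(x <- s) ('X - x%:P),
        count (@padic_unit p Qb) s = n
      & count (@padic_dvd p Qb (p ^ a)%:R) s = n];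
  deligne_middle : coprimez p%:Z (char_poly (end_mx b F))`_n;
  deligne_verschiebung : exists V : {additive T -> T},
    is_verschiebung (p ^ a) F V
}.

(** * The algebra Q[F] and polarizations *)

Definition eval_mx (r : nat) (M : 'M[rat]_r) (P : {poly rat}) : 'M[rat]_r :=
  \sum_(i < size P) P`_i *: M ^+ i.

Definition in_QF (r : nat) (M A : 'M[rat]_r) : Prop :=
  exists P : {poly rat}, A = eval_mx M P.

(* A homomorphism Q[M] -> C is represented by a function on all matrices, of
   which only the values on Q[M] are relevant. *)
Definition QF_hom (C : numClosedFieldType) (r : nat) (M : 'M[rat]_r)
    (phi : 'M[rat]_r -> C) : Prop :=
  [/\ phi 1%:M = 1,
      forall A B, in_QF M A -> in_QF M B -> phi (A + B) = phi A + phi B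
    & forall A B, in_QF M A -> in_QF M B -> phi (A *m B) = phi A * phi B].

Definition cm_type (C : numClosedFieldType) (v : C -> rat) (r : nat)
    (M : 'M[rat]_r) (phi : 'M[rat]_r -> C) : Prop :=
  QF_hom M phi /\ 0 < v (phi M).

(* [B] is the complex conjugate of [A] in Q[F], conjugation being the
   automorphism of Q[F] that sends F (matrix [M]) to V (matrix [N]). *)
Definition cm_conj (r : nat) (M N A B : 'M[rat]_r) : Prop :=
  exists P : {poly rat}, A = eval_mx M P /\ B = eval_mx N P.

Definition totally_positive_imaginary (C : numClosedFieldType) (v : C -> rat)
    (r : nat) (M N iota : 'M[rat]_r) : Prop :=
  cm_conj M N iota (- iota) /\
  (forall phi : 'M[rat]_r -> C, cm_type v M phi ->
     'Re (phi iota) = 0 /\ 0 < 'Im (phi iota)).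

Record is_polarization (C : numClosedFieldType) (v : C -> rat) (q r : nat)
    (T : zmodType) (b : zbasis T r) (F : {additive T -> T})
    (w : T -> T -> int) : Prop := IsPolarization {
  pol_addl : forall x y z, w (x + y) z = w x z + w y z;
  pol_addr : forall x y z, w x (y + z) = w x y + w x z;
  pol_alt : forall x, w x x = 0;
  pol_nondegenerate : forall x : 'rV[rat]_r,
    (forall y, formQ b w x y = 0) -> x = 0;
  pol_positive : exists V : {additive T -> T},
    [/\ is_verschiebung q F V,
        forall x y, w (F x) y = w x (V y)
      & exists iota : 'M[rat]_r,
          let Rform x y := formQ b w x (y *m iota) in
          [/\ totally_positive_imaginary v (base_change rat (end_mx b F))
                (base_change rat (end_mx b V)) iota,
              forall x y, Rform x y = Rform y x
            & forall x, x != 0 -> 0 < Rform x x]]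
}.

Definition polarized_deligne_module (R : realType) (v : R[i] -> rat)
    (p a n : nat) (Qb : padic_closure p) (T : zmodType)
    (b : zbasis T (2 * n)) (F : {additive T -> T}) (w : T -> T -> int) : Prop :=
  is_deligne_module R a Qb b F /\ is_polarization v (p ^ a) b F w.

Definition deligne_isomorphic (T1 T2 : zmodType) (F1 : T1 -> T1)
    (w1 : T1 -> T1 -> int) (F2 : T2 -> T2) (w2 : T2 -> T2 -> int) : Prop :=
  exists psi : {additive T1 -> T2},
    [/\ bijective psi,
        forall x, psi (F1 x) = F2 (psi x)
      & forall x y, w2 (psi x) (psi y) = w1 x y].

Definition admits_real_structure (T : zmodType) (F V : T -> T)
    (w : T -> T -> int) : Prop :=
  exists (tau : {additive T -> T}) (tau' : T -> T),
    [/\ cancel tau tau' /\ cancel tau' tau,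
        forall x, tau (tau x) = x,
        forall x, tau (F (tau' x)) = V x
      & forall x y, w (tau x) (tau y) = - w x y].

(* Main.v *)
Require Import Defs.
From HB Require Import structures.
From mathcomp Require Import all_boot all_order all_algebra all_field.
From mathcomp Require Import reals complex.

Set Implicit Arguments.
Unset Strict Implicit.
Unset Printing Implicit Defensive.

Import Order.TTheory GRing.Theory Num.Theory.
Local Open Scope ring_scope.

(* Since omega is nondegenerate and V is the adjoint of F, the matrices of F and
   V are similar up to transposition; hence F and V have the same
   characteristic polynomial and the conjugation F <-> V of Q[F] is the
   adjunction for omega. Composing with it exchanges the two CM types, so -iota
   is positive imaginary for (T, V).
   In the simple case let psi : (T, F, omega) -> (T, V, -omega) be an
   isomorphism. As T (x) Q is cyclic, psi sends a generator u to beta u with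
   beta in Q[F], and psi^2 = beta * conj(beta). This is self-adjoint and
   preserves omega, so its square is 1 and by simplicity psi^2 = 1 or -1. The
   Rosati form R satisfies R(psi^2 x, x) = R(beta x, beta x) >= 0, which
   excludes -1; hence psi itself is a real structure. *)

Lemma mulmx_rV_inj (K : nzRingType) (m n : nat) (A B : 'M[K]_(m, n)) :
  (forall u : 'rV_m, u *m A = u *m B) -> A = B.
Proof. by move=> eqAB; apply/row_matrixP=> i; rewrite !rowE. Qed.

Lemma mulmx_form_inj (K : nzRingType) (m n : nat) (A B : 'M[K]_(m, n)) :
  (forall (u : 'rV_m) (v : 'rV_n),
     (u *m A *m v^T) 0 0 = (u *m B *m v^T) 0 0) -> A = B.
Proof.
move=> eqAB; apply/matrixP=> i j.
have := eqAB (delta_mx 0 i) (delta_mx 0 j).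
by rewrite -!rowE trmx_delta -!colE !mxE.
Qed.

(** [W] intertwines X - M and X - N^T, so taking determinants and cancelling that of [W] suffices.
    Stated over a domain so as to apply to integer forms that are not unimodular. *)
Lemma intertwine_trmx_char_poly (K : idomainType) (r : nat) (M N W : 'M[K]_r) :
  \det W != 0 -> M *m W = W *m N^T -> char_poly M = char_poly N.
Proof.
move=> W0 MW; rewrite -[char_poly N]det_tr.
have W'0 : \det (map_mx polyC W) != 0 by rewrite det_map_mx polyC_eq0.
apply: (mulIf W'0); rewrite [RHS]mulrC -!det_mulmx; congr (\det _).
rewrite /char_poly_mx linearB /= tr_scalar_mx map_trmx mulmxBl mulmxBr.
by rewrite scalar_mxC -!map_mxM MW.
Qed.

(** * Polynomials in a matrix *)

Section EvalMx.
Variable r : nat.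
Implicit Types (M N A : 'M[rat]_r) (P Q : {poly rat}).

Lemma eval_mx_intertwine M N A P :
  M *m A = A *m N -> eval_mx M P *m A = A *m eval_mx N P.
Proof.
move=> MA; rewrite mulmx_suml mulmx_sumr; apply: eq_bigr => i _.
rewrite -scalemxAl -scalemxAr; congr (_ *: _).
elim: (i : nat) => [|m IHm]; first by rewrite !expr0 mul1mx mulmx1.
by rewrite !exprS -[M * _]/(M *m _) -[N * _]/(N *m _) -mulmxA IHm !mulmxA MA.
Qed.

Lemma tr_eval_mx M P : (eval_mx M P)^T = eval_mx M^T P.
Proof.
rewrite linear_sum; apply: eq_bigr => i _; rewrite linearZ /=; congr (_ *: _).
elim: (i : nat) => [|m IHm]; first by rewrite !expr0 trmx1.
by rewrite exprS exprSr -[M * _]/(M *m _) -[_ * M^T]/(_ *m M^T) trmx_mul IHm.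
Qed.

Lemma eval_mx_comm M P Q : comm_mx (eval_mx M P) (eval_mx M Q).
Proof. by apply/eval_mx_intertwine/esym/eval_mx_intertwine. Qed.

Lemma eval_mxX M : eval_mx M 'X = M.
Proof.
rewrite /eval_mx size_polyX big_ord_recl big_ord1 !coefX /= scale0r add0r.
by rewrite scale1r expr1.
Qed.

Lemma eval_mx1 M : eval_mx M 1 = 1%:M.
Proof. by rewrite /eval_mx size_poly1 big_ord1 coef1 scale1r expr0. Qed.
End EvalMx.

Lemma eval_horner_mx (r : nat) (M : 'M[rat]_r.+1) P :
  eval_mx M P = horner_mx M P.
Proof.
rewrite -{2}[P]coefK poly_def rmorph_sum; apply: eq_bigr => i _.
by rewrite /= linearZ /= rmorphXn /= horner_mx_X.
Qed.

(** * Adjunction with respect to the form, and CM types *)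

Section Intertwining.
Variables (r : nat) (M N W : 'M[rat]_r).
Hypotheses (W_unit : W \in unitmx) (MW : M *m W = W *m N^T).

Lemma eval_mx_adjoint P : eval_mx M P *m W = W *m (eval_mx N P)^T.
Proof. by rewrite tr_eval_mx; apply: eval_mx_intertwine. Qed.

(* Conjugation of Q[M] is the restriction of the adjunction with respect to
   [W], so it turns homomorphisms on Q[N] into homomorphisms on Q[M]. *)
Lemma totally_positive_imaginary_swap (C : numClosedFieldType) (v : C -> rat)
    (iota : 'M[rat]_r) :
  totally_positive_imaginary v M N iota ->
  totally_positive_imaginary v N M (- iota).
Proof.
move=> [[P [iotaM iotaN]] posM]; split; first by exists P; rewrite opprK.
move=> phi [[phi1 phiD phiM] phiN].
pose adj A := (invmx W *m A *m W)^T.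
have adjE Q : adj (eval_mx M Q) = eval_mx N Q.
  by rewrite /adj -mulmxA eval_mx_adjoint mulKmx ?trmxK.
have adjM A B : adj (A *m B) = adj B *m adj A.
  by rewrite /adj -trmx_mul !mulmxA mulmxK.
have adjQ A : in_QF M A -> in_QF N (adj A).
  by move=> [Q ->]; exists Q; rewrite adjE.
(* Conjugation sends [iota] to [- iota], so [phi (- iota)] is the value at [iota] of [phi \o adj],
   which lies in the CM type of [M] because [adj M] is [N]. *)
rewrite iotaN -adjE -iotaM.
apply: (posM (phi \o adj)); split; last first.
  by rewrite /= -[M]eval_mxX adjE eval_mxX.
split=> [|A B QA QB|A B QA QB] /=.
- by rewrite -(eval_mx1 M) adjE eval_mx1.
- rewrite -phiD; [|exact: adjQ|exact: adjQ].
  by rewrite /adj mulmxDr mulmxDl linearD.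
- by rewrite adjM [RHS]mulrC; apply: phiM; exact: adjQ.
Qed.
End Intertwining.

(** Up to the scalar [c], [N] is the inverse of [M], so both have the same stable subspaces. *)
Lemma semisimple_mx_quasi_inverse (r : nat) (M N : 'M[rat]_r) (c : rat) :
  c != 0 -> M *m N = c%:M -> semisimple_mx M -> semisimple_mx N.
Proof.
move=> c0 MN.
have NM : N *m M = c%:M.
  have MNc : M *m (c^-1 *: N) = 1%:M.
    by rewrite -scalemxAr MN scale_scalar_mx mulVf.
  have /(congr1 ( *:%R c)) := mulmx1C MNc.
  by rewrite scale_scalar_mx mulr1 -scalemxAl scalerA mulfV ?scale1r.
have stable_sub (A B U : 'M[rat]_r) :
    A *m B = c%:M -> stablemx U A -> stablemx U B.
  move=> AB UA.
  have A_unit : row_free A.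
    apply/row_freeP; exists (c^-1 *: B).
    by rewrite -scalemxAr AB scale_scalar_mx mulVf.
  (* [A] is injective, so U A = U by dimension; multiplying by [B] puts U B inside c U. *)
  have : (U <= U *m A)%MS.
    by have := mxrank_leqif_sup UA; rewrite mxrankMfree // => -[_ <-].
  move=> /(submxMr B) /submx_trans; apply.
  by rewrite -mulmxA AB mul_mx_scalar scalemx_sub.
move=> ssM U UN; have [U' [U'M dUU' fUU']] := ssM U (stable_sub _ _ _ NM UN).
by exists U'; split=> //; apply: stable_sub U'M.
Qed.

(** The vectors u P(M) form a nonzero stable subspace, which simplicity forces to be everything. *)
Lemma cyclic_vector (r : nat) (M : 'M[rat]_r) (u x : 'rV[rat]_r) :
  (forall U : 'M[rat]_r, stablemx U M -> U = 0 \/ row_full U) ->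
  u != 0 -> exists P, x = u *m eval_mx M P.
Proof.
case: r M u x => [|r] M u x; first by rewrite [u]thinmx0 eqxx.
move=> simple u0.
(* The rows of [U] are the u M^i for i below the degree of the minimal polynomial of [M]. *)
pose U := powers_mx M (degree_mxminpoly M) *m
  lin1_mx (mulmx u \o vec_mx : 'rV_(r.+1 * r.+1) -> 'rV_r.+1).
have memU P : (u *m horner_mx M P <= U)%MS.
  have /(submxMr (lin1_mx (mulmx u \o vec_mx))) := horner_mx_mem M P.
  by rewrite mul_rV_lin1 /= mxvecK.
have Urow y : (y <= U)%MS -> exists P, y = u *m horner_mx M P.
  case/submxP=> D ->; exists (rVpoly D).
  by rewrite mulmxA mul_rV_lin1 /= horner_rVpoly.
have UM : stablemx <<U>>%MS M.
  rewrite (eqmxMr M (genmxE U)) genmxE; apply/row_subP=> i.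
  rewrite row_mul; have [P ->] := Urow _ (row_sub i U).
  rewrite -mulmxA -[X in _ *m (_ *m X)]horner_mx_X.
  by rewrite -[horner_mx M P *m _]rmorphM; apply: memU.
have [U0|] := simple _ UM.
  case/eqP: u0; have := memU 1; rewrite -(genmxE U) U0 rmorph1 mulmx1 submx0.
  by move/eqP.
rewrite /row_full genmxE => U_full.
have [P ->] := Urow x (submx_full x U_full).
by exists P; rewrite eval_horner_mx.
Qed.

(** Matrix form of the simple case: [A] stands for psi, [W] for omega, [M] for F and [N] for V. *)
Lemma conjugate_isometry_involutive (r : nat) (M N W A iota : 'M[rat]_r) :
  W \in unitmx -> W^T = - W -> M *m W = W *m N^T -> comm_mx M N ->
  (0 < r)%N ->
  (forall U : 'M[rat]_r, stablemx U M -> U = 0 \/ row_full U) ->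
  M *m A = A *m N -> N *m A = A *m M -> A *m W *m A^T = - W ->
  in_QF M iota ->
  (forall x : 'rV[rat]_r, x != 0 -> 0 < (x *m W *m (x *m iota)^T) 0 0) ->
  A *m A = 1%:M.
Proof.
move=> W_unit W_alt MW MN r0 simple MA NA AW [Q iotaE] pos.
pose u : 'rV[rat]_r := delta_mx 0 (Ordinal r0).
have u0 : u != 0.
  by apply/eqP=> /matrixP/(_ 0 (Ordinal r0)); rewrite !mxE !eqxx /=.
have [P uA] := cyclic_vector (u *m A) simple u0.
pose B := eval_mx M P; pose B' := eval_mx N P.
have MNQ : comm_mx (eval_mx M P) (eval_mx N P).
  by apply: eval_mx_intertwine; apply/esym/eval_mx_intertwine/esym.
have AM : comm_mx (A *m A) M by rewrite /comm_mx -mulmxA -NA mulmxA -MA -mulmxA.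
have BM : comm_mx (B *m B') M.
  have BM : comm_mx B M by apply: eval_mx_intertwine.
  have B'M : comm_mx B' M by apply: eval_mx_intertwine; apply/esym.
  by rewrite /comm_mx -mulmxA B'M mulmxA BM mulmxA.
(* Both sides commute with [M], so they need only agree on the cyclic vector: u A A = u B A = u A B'
   = u B B'. *)
have AAE : A *m A = B *m B'.
  apply: mulmx_rV_inj => x; have [S ->] := cyclic_vector x simple u0.
  rewrite -!mulmxA (eval_mx_intertwine S (esym AM)).
  rewrite (eval_mx_intertwine S (esym BM)).
  rewrite !mulmxA uA -/B -[u *m B *m A]mulmxA (eval_mx_intertwine P MA) -/B'.
  by rewrite mulmxA uA.
pose Z := B *m B'.
(* [B] and [B'] are adjoint to each other and commute, so [Z] is self-adjoint. *)
have ZW : Z *m W = W *m Z^T.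
  have NW : N *m W = W *m M^T.
    have := congr1 trmx MW.
    by rewrite !trmx_mul trmxK W_alt mulNmx mulmxN => /oppr_inj.
  rewrite /Z trmx_mul -mulmxA /B' (eval_mx_adjoint NW) mulmxA.
  by rewrite (eval_mx_adjoint MW) -mulmxA -!trmx_mul MNQ.
(* [A] reverses the sign of the form, so its square preserves it. *)
have ZWZ : Z *m W *m Z^T = W.
  rewrite -/Z in AAE; rewrite -AAE trmx_mul.
  have -> : A *m A *m W *m (A^T *m A^T) = A *m (A *m W *m A^T) *m A^T.
    by rewrite !mulmxA.
  by rewrite AW mulmxN mulNmx AW opprK.
have ZZ : (Z - 1%:M) *m (Z + 1%:M) = 0.
  rewrite mulmxBl mul1mx mulmxDr mulmx1 opprD addrA addrK; apply/eqP.
  rewrite subr_eq0; apply/eqP/(can_inj (mulmxK W_unit)).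
  by rewrite mul1mx -mulmxA ZW mulmxA ZWZ.
rewrite AAE -/Z.
(* By simplicity ker(Z - 1) is everything or zero; in the second case Z - 1 is invertible and [ZZ]
   gives Z = -1. *)
have kerM : stablemx (kermx (Z - 1%:M)) M.
  apply: comm_mx_stable_ker; rewrite /comm_mx mulmxBl mulmxBr BM.
  by rewrite mul1mx mulmx1.
have [/eqP|ker_full] := simple _ kerM; last first.
  have /sub_kermxP : (1%:M <= kermx (Z - 1%:M))%MS := submx_full _ ker_full.
  by rewrite mul1mx => /eqP; rewrite subr_eq0 => /eqP.
rewrite kermx_eq0 row_free_unit => Z1_unit; exfalso.
have ZN1 : Z = - 1%:M.
  apply/eqP; rewrite -subr_eq0 opprK; apply/eqP.
  by rewrite -[LHS](mulKmx Z1_unit) ZZ mulmx0.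
(* Moving [B] across the form turns R(uB, uB) into omega(u, u iota B B') = -R(u, u) < 0 when Z = -1.
   The bound is non-strict so as to cover u B = 0. *)
have posN (y : 'rV[rat]_r) : 0 <= (y *m W *m (y *m iota)^T) 0 0.
  have [->|/pos/ltW//] := eqVneq y 0; by rewrite !mul0mx mxE.
have := posN (u *m B); apply/negP; rewrite -ltNge.
have -> : u *m B *m W *m (u *m B *m iota)^T = - (u *m W *m (u *m iota)^T).
  rewrite !trmx_mul -!mulmxA -mulmxN; congr (u *m _).
  rewrite mulmxA /B (eval_mx_adjoint MW) -/B -/B' -mulmxA -mulmxN.
  congr (W *m _).
  rewrite !mulmxA -mulNmx; congr (_ *m _).
  rewrite -!trmx_mul iotaE mulmxA eval_mx_comm -mulmxA -/B -/B' -/Z ZN1.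
  by rewrite mulmxN mulmx1 linearN.
by rewrite mxE oppr_lt0 pos.
Qed.

(** * Passage from T and its forms to integer matrices *)

Section Coordinates.
Variables (T : zmodType) (r : nat) (b : zbasis T r).
Implicit Types (F G : {additive T -> T}) (w : T -> T -> int).

Lemma zcoord_inj : injective (zcoord b).
Proof. exact: can_inj (zcoordK b). Qed.

Lemma zvec_row_sum (u : 'rV[int]_r) :
  zvec b u = \sum_i zvec b (delta_mx 0 i) *~ u 0 i.
Proof.
apply: zcoord_inj; rewrite zvecK raddf_sum {1}[u]row_sum_delta.
by apply: eq_bigr => i _; rewrite raddfMz zvecK -scaler_int intz.
Qed.

Lemma zcoord_end_mx F x : zcoord b (F x) = zcoord b x *m end_mx b F.
Proof.
rewrite -[x in LHS](zcoordK b) zvec_row_sum !raddf_sum mulmx_sum_row.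
apply: eq_bigr => i _; rewrite !raddfMz -scaler_int intz; congr (_ *: _).
by apply/rowP=> j; rewrite !mxE.
Qed.

Lemma end_mxM_eq F1 G1 F2 G2 : (forall x, G1 (F1 x) = G2 (F2 x)) ->
  end_mx b F1 *m end_mx b G1 = end_mx b F2 *m end_mx b G2.
Proof.
move=> eqFG; apply: mulmx_rV_inj => u.
by rewrite -[u](zvecK b) !mulmxA -!zcoord_end_mx eqFG.
Qed.

Lemma end_mxM_scalar F G q : (forall x, G (F x) = x *+ q) ->
  end_mx b F *m end_mx b G = q%:R%:M.
Proof.
move=> FG; apply: mulmx_rV_inj => u.
rewrite -[u](zvecK b) !mulmxA -!zcoord_end_mx FG raddfMn mul_mx_scalar.
by rewrite scaler_nat.
Qed.

Lemma form_mxE w :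
  (forall x y z, w (x + y) z = w x z + w y z) ->
  (forall x y z, w x (y + z) = w x y + w x z) ->
  forall x y, w x y = (zcoord b x *m form_mx b w *m (zcoord b y)^T) 0 0.
Proof.
move=> wDl wDr x y.
have additiveM (f : T -> int) : {morph f : u u' / u + u'} ->
    forall u, f u = \sum_i zcoord b u 0 i * f (zvec b (delta_mx 0 i)).
  move=> fD u; have f0 : f 0 = 0 by apply: (addrI (f 0)); rewrite -fD !addr0.
  have fB : zmod_morphism f.
    by move=> u1 u2; apply: (addIr (f u2)); rewrite -fD !subrK.
  (* Bundling a slot of [w] as a morphism lets it commute with the expansion in the basis. *)
  pose g : {additive T -> int} :=
    HB.pack f (GRing.isZmodMorphism.Build _ _ f fB).
  rewrite -[f u]/(g u) -{1}[u](zcoordK b) zvec_row_sum raddf_sum.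
  by apply: eq_bigr => i _; rewrite raddfMz -mulrzr intz mulrC.
rewrite (additiveM (w^~ y)) => [|u u']; last exact: wDl.
rewrite -mulmxA mxE; apply: eq_bigr => i _; congr (_ * _).
rewrite (additiveM (w _)) ?mxE => [|u u']; last exact: wDr.
by apply: eq_bigr => j _; rewrite !mxE mulrC.
Qed.

Lemma form_mx_eq w F G :
  (forall x y z, w (x + y) z = w x z + w y z) ->
  (forall x y z, w x (y + z) = w x y + w x z) ->
  (forall x y, w (F x) y = w x (G y)) ->
  end_mx b F *m form_mx b w = form_mx b w *m (end_mx b G)^T.
Proof.
move=> wDl wDr FG; apply: mulmx_form_inj => x y.
rewrite -[x](zvecK b) -[y](zvecK b) !mulmxA -zcoord_end_mx -form_mxE // FG.
by rewrite form_mxE // zcoord_end_mx trmx_mul !mulmxA.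
Qed.

Lemma form_mx_anti_isometry w F :
  (forall x y z, w (x + y) z = w x z + w y z) ->
  (forall x y z, w x (y + z) = w x y + w x z) ->
  (forall x y, w (F x) (F y) = - w x y) ->
  end_mx b F *m form_mx b w *m (end_mx b F)^T = - form_mx b w.
Proof.
move=> wDl wDr FF; apply: mulmx_form_inj => x y.
rewrite -[x](zvecK b) -[y](zvecK b) !mulmxA -zcoord_end_mx -mulmxA -trmx_mul.
by rewrite -zcoord_end_mx mulmxN mulNmx [RHS]mxE -!form_mxE.
Qed.

Lemma formQ_opp w x y : formQ b (fun x y => - w x y) x y = - formQ b w x y.
Proof.
rewrite /formQ (_ : form_mx b _ = - form_mx b w); last first.
  by apply/matrixP=> i j; rewrite !mxE.
by rewrite /base_change map_mxN mulmxN mulNmx mxE.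
Qed.

Lemma formQ_nondegenerate w :
  (forall x, (forall y, formQ b w x y = 0) -> x = 0) ->
  base_change rat (form_mx b w) \in unitmx.
Proof.
move=> ndg; rewrite -row_free_unit; apply: inj_row_free => x xW0.
by apply: ndg => y; rewrite /formQ xW0 mul0mx mxE.
Qed.

(** A free module is torsion-free; this allows q to be cancelled in relations between F and V. *)
Lemma mulrn_zbasis_inj q : (0 < q)%N -> injective (fun x : T => x *+ q).
Proof.
move=> q0 x y /(congr1 (zcoord b)) /=; rewrite !raddfMn => eqxy.
apply: zcoord_inj; apply/rowP=> i; move/rowP/(_ i): eqxy.
by move/eqP; rewrite !mulmxnE eqr_pMn2r // => /eqP.
Qed.
End Coordinates.

(** q V = V F V = V F V' = q V', and q cancels. This identifies the V supplied by a polarization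
    with the given one. *)
Lemma verschiebung_unique (T : zmodType) (r q : nat) (b : zbasis T r)
    (F V V' : {additive T -> T}) : (0 < q)%N ->
  is_verschiebung q F V -> is_verschiebung q F V' -> V =1 V'.
Proof.
move=> q0 [FV VF] [FV' _] x; apply: (mulrn_zbasis_inj b q0).
by rewrite /= -!VF FV FV'.
Qed.

Lemma eq_end_mx (T : zmodType) (r : nat) (b : zbasis T r) (F G : T -> T) :
  F =1 G -> end_mx b F = end_mx b G.
Proof. by move=> eqFG; apply/matrixP=> i j; rewrite !mxE eqFG. Qed.

Lemma base_change_rat_inj (r : nat) : injective (@base_change rat r).
Proof.
move=> A B /matrixP eqAB; apply/matrixP=> i j; apply: (@intr_inj rat).
by have := eqAB i j; rewrite !mxE.
Qed.

Lemma base_change_eigenvalue (F : fieldType) (r : nat) (M : 'M[int]_r) :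
  eigenvalue (base_change F M) =1 root (map_poly intr (char_poly M)).
Proof. by move=> z; rewrite eigenvalue_root_char map_char_poly. Qed.

Theorem lemma1p4
    (R : realType) (p a n : nat) (hp : prime p) (ha : (0 < a)%N)
    (k : finFieldType) (hk : #|k| = (p ^ a)%N)
    (kbar : closedFieldType) (ik : {rmorphism k -> kbar})
    (hkbar : forall x : kbar, algebraicOver ik x)
    (eps : witt kbar -> R[i]) (heps : witt_embedding p eps)
    (v : R[i] -> rat) (hv : induced_valuation p eps v)
    (Qb : padic_closure p)
    (T : zmodType) (b : zbasis T (2 * n)) (F V : {additive T -> T})
    (w : T -> T -> int)
    (hpol : polarized_deligne_module v a Qb b F w)
    (hV : is_verschiebung (p ^ a) F V) :
  polarized_deligne_module v a Qb b V (fun x y => - w x y) /\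
  (simple_QF_module b F ->
   (deligne_isomorphic F w V (fun x y => - w x y) <->
    admits_real_structure F V w)).
Proof.
have q0 : (0 < p ^ a)%N by rewrite expn_gt0 prime_gt0.
have [[ssF weil ordinary middle _] [wDl wDr w_alt ndg]] := hpol.
move=> [V' [hV' wFV' [iota [iota_pos iota_sym R_pos]]]].
have eqV : V' =1 V := verschiebung_unique b q0 hV' hV.
have wFV x y : w (F x) y = w x (V y) by rewrite wFV' eqV.
rewrite (eq_end_mx b eqV) in iota_pos.
have wN x y : w x y = - w y x.
  apply/eqP; rewrite -addr_eq0; apply/eqP.
  by have := w_alt (x + y); rewrite wDl !wDr !w_alt add0r addr0.
have wVF x y : w (V x) y = w x (F y) by rewrite wN -wFV -wN.
set M := base_change rat (end_mx b F) in ssF iota_pos *.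
set N := base_change rat (end_mx b V) in iota_pos *.
pose W := base_change rat (form_mx b w).
have W_unit : W \in unitmx by apply: formQ_nondegenerate.
have MW : M *m W = W *m N^T.
  rewrite /M /W /N /base_change map_trmx -!map_mxM.
  by rewrite (form_mx_eq _ wDl wDr wFV).
have [FV VF] := hV.
have FVq := end_mxM_scalar b FV; have VFq := end_mxM_scalar b VF.
have qmx : base_change rat (p ^ a)%:R%:M =
    (p ^ a)%:R%:M :> 'M[rat]_(2 * n).
  by rewrite /base_change map_scalar_mx rmorph_nat.
have NM : N *m M = (p ^ a)%:R%:M by rewrite -map_mxM FVq; exact: qmx.
have MN : M *m N = (p ^ a)%:R%:M by rewrite -map_mxM VFq; exact: qmx.
(* The Weil, ordinarity and middle coefficient conditions depend only on this polynomial. *)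
have char_eq : char_poly (end_mx b F) = char_poly (end_mx b V).
  apply: intertwine_trmx_char_poly (form_mx_eq b wDl wDr wFV).
  by move: W_unit; rewrite unitmxE unitfE det_map_mx intr_eq0.
split.
  split; split.
  - by apply: semisimple_mx_quasi_inverse MN ssF; rewrite pnatr_eq0 -lt0n.
  - move=> z; rewrite base_change_eigenvalue -char_eq -base_change_eigenvalue.
    exact: weil.
  - have [s [sE s_unit s_dvd]] := ordinary; exists s; split=> //.
    by rewrite -sE -!map_char_poly char_eq.
  - by rewrite -char_eq.
  - by exists F; split.
  - by move=> x y z; rewrite wDl opprD.
  - by move=> x y z; rewrite wDr opprD.
  - by move=> x; rewrite w_alt oppr0.
  - move=> x x0; apply: ndg => y; apply: oppr_inj.
    by rewrite -formQ_opp x0 oppr0.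
  - exists F; split; [by split | by move=> x y; rewrite wVF |].
    (* The signs of -omega and -iota cancel, so both modules have the same Rosati form. *)
    have formN x y : formQ b (fun x y => - w x y) x (y *m (- iota)) =
        formQ b w x (y *m iota).
      by rewrite formQ_opp /formQ mulmxN linearN mulmxN mxE opprK.
    exists (- iota); split.
    + exact: (totally_positive_imaginary_swap W_unit MW iota_pos).
    + by move=> x y; rewrite !formN iota_sym.
    + by move=> x x0; rewrite formN R_pos.
move=> [r0 simple]; split=> [[psi [[psi' psiK psi'K] psiF psiw]]|]; last first.
  (* A real structure is itself an isomorphism onto (T, V, -omega). *)
  move=> [tau [tau' [[tauK tau'K] _ tauF tauw]]].
  exists tau; split; first by exists tau'.
    by move=> x; rewrite -tauF tauK.
  by move=> x y; rewrite tauw opprK.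
have psiwN x y : w (psi x) (psi y) = - w x y by rewrite -(psiw x y) opprK.
(* With q = F V: q psi V = F V psi V = F psi F V = q F psi. *)
have psiV x : psi (V x) = F (psi x).
  apply: (mulrn_zbasis_inj b q0) => /=.
  by rewrite -(FV (psi (V x))) -psiF FV !raddfMn.
pose A := base_change rat (end_mx b psi).
have AA : A *m A = 1%:M.
  have iotaQ : in_QF M iota by have [[P [iotaE _]] _] := iota_pos; exists P.
  apply: conjugate_isometry_involutive W_unit _ MW _ r0 simple _ _ _ iotaQ R_pos.
  - by apply/matrixP=> i j; rewrite !mxE wN rmorphN.
  - by rewrite /comm_mx MN.
  - by rewrite -!map_mxM (end_mxM_eq b psiF).
  - by rewrite -!map_mxM (end_mxM_eq b psiV).
  - rewrite map_trmx -!map_mxM (form_mx_anti_isometry b wDl wDr psiwN).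
    exact: map_mxN.
exists psi, psi'; split=> // [x|x]; last by rewrite psiF psi'K.
apply: (zcoord_inj (b := b)); rewrite !zcoord_end_mx -mulmxA.
(* psi^2 = 1 is known over Q and descends to the integer matrix of psi. *)
suff -> : end_mx b psi *m end_mx b psi = 1%:M by rewrite mulmx1.
by apply: base_change_rat_inj; rewrite /base_change map_mxM map_mx1.
Qed.
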